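(* Let $d\ge1$, $n\ge d+1$, $T=\{t_1<\dots<t_n\}\subset\mathbb R$, $\sigma$ a chamber, and $T=I_1\cup\dots\cup I_{k+1}$ the signed $\sigma$-decomposition, with $I_j=\{t_{j,1}<\dots<t_{j,n_j}\}$. A subset $S\subset T$ with $|S|=d$ corresponds to a facet of $P_\sigma(T)$ if and only if there is a decomposition $S=S_1\sqcup S_2\sqcup S_3$ such that (S1) $S_1=\{S_1^1,\dots,S_1^k\}$ consists of $k$ distinct elements with $S_1^j\in\{t_{j,n_j},t_{j+1,1}\}$ for each $j\in[k]$; (S2) $S_2\in\{\emptyset,\{t_{1,1}\},\{t_{k+1,n_{k+1}}\},\{t_{1,1},t_{k+1,n_{k+1}}\}\}$ and $d-k-|S_2|$ is even; (S3) $S_3$ consists of the remaining $d-k-|S_2|$ points, which occur as $\frac{d-k-|S_2|}{2}$ consecutive pairs. Furthermore, for each facet this decomposition is unique.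
   Context: $\nu_d(t)=(1,t,\dots,t^d)$, $q_\xi(t)=\sum_{i=0}^d\xi_it^i$. A chamber $\sigma$ is the closure of a connected component of the complement in $\mathbb R^{d+1}$ of the hyperplanes $\{\xi:q_\xi(t)=0\}$, $t\in T$; $P_\sigma(T)=\mathrm{conv}\{\nu_d(t)/q_\xi(t):t\in T\}$ for any $\xi$ in the interior of $\sigma$ (a $d$-polytope whose combinatorial type depends only on $\sigma$). The signed $\sigma$-decomposition partitions $T$ into the maximal runs $I_1<\dots<I_{k+1}$ of consecutive elements on which $\mathrm{sgn}\,q_\xi$ is constant ($0\le k\le d$). $S$ corresponds to a facet if $\{\nu_d(t)/q_\xi(t):t\in S\}$ is the vertex set of a facet. A consecutive pair is a pair $\{t_{j,i},t_{j,i+1}\}$ of consecutive elements of the same $I_j$. *)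

(* Defs.v *)
From HB Require Import structures.
From mathcomp Require Import all_boot all_order all_algebra.
From mathcomp Require Import all_classical all_reals.
From mathcomp Require Import topology normedtype convex.

Set Implicit Arguments.
Unset Strict Implicit.
Unset Printing Implicit Defensive.

Import Order.TTheory GRing.Theory Num.Theory.
Import numFieldNormedType.Exports.

Local Open Scope classical_set_scope.
Local Open Scope ring_scope.

Section Polytopes.
Context {R : realType} {N : nat}.
Implicit Types (X P F : set 'rV[R]_N).

Definition dot (c x : 'rV[R]_N) : R := \sum_(i < N) c 0 i * x 0 i.

Definition convex_hull X : set 'rV[R]_N :=
  smallest (@convex_set R (convex_lmodType 'rV[R]_N)) X.

Definition affine_hull X : set 'rV[R]_N :=
  [set y | exists m (p : 'I_m -> 'rV[R]_N) (a : 'I_m -> R),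
     [/\ forall i, X (p i), \sum_i a i = 1 & y = \sum_i a i *: p i]].

(* [X] is nonempty and its affine hull is a translate of an [m]-dimensional
   linear subspace. *)
Definition has_dim X (m : nat) : Prop :=
  exists (x : 'rV[R]_N) (U : {vspace 'rV[R]_N}),
    affine_hull X = [set x + u | u in [set` U]] /\ (\dim U)%VS = m.

(* The trivial faces (the empty set and [P]) are included. *)
Definition is_face P F : Prop :=
  exists (c : 'rV[R]_N) (b : R),
    (forall x, P x -> dot c x <= b) /\ F = P `&` [set x | dot c x = b].

Definition is_facet P F : Prop :=
  is_face P F /\ exists m, has_dim P m.+1 /\ has_dim F m.

Definition vertices P : set 'rV[R]_N := [set v | is_face P [set v]].

End Polytopes.

Section Chambers.
Context {R : realType} {d n : nat}.
(* The points of T are [t 0 < ... < t (n - 1)], and subsets of T are given by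
   their sets of indices. *)
Implicit Types (t : 'I_n -> R) (xi : 'rV[R]_d.+1) (sigma : set 'rV[R]_d.+1).

Definition nu (s : R) : 'rV[R]_d.+1 := \row_(i < d.+1) s ^+ i.

Definition q xi (s : R) : R := \sum_(i < d.+1) xi 0 i * s ^+ i.

Definition hyperplane_complement t : set 'rV[R]_d.+1 :=
  ~` \bigcup_(i in [set: 'I_n]) [set xi | q xi (t i) = 0].

Definition chamber t sigma : Prop :=
  exists2 xi, hyperplane_complement t xi &
    sigma = closure (connected_component (hyperplane_complement t) xi).

Definition point t xi (i : 'I_n) : 'rV[R]_d.+1 := (q xi (t i))^-1 *: nu (t i).

Definition polytope t xi : set 'rV[R]_d.+1 :=
  convex_hull (range (point t xi)).

Definition corresponds_to_facet t xi (S : {set 'I_n}) : Prop :=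
  exists2 F, is_facet (polytope t xi) F &
    vertices F = point t xi @` [set` S].

Definition run t xi (A : {set 'I_n}) : bool :=
  [&& A != finset.set0,
      [forall i in A, forall j in A, forall l : 'I_n,
         (i <= l <= j)%N ==> (l \in A)]
    & [forall i in A, forall j in A,
         Num.sg (q xi (t i)) == Num.sg (q xi (t j))]].

(* The block [I_j] (1 <= j <= k+1) is [I (j-1)]. *)
Definition signed_decomposition t xi (k : nat) (I : 'I_k.+1 -> {set 'I_n}) :
    Prop :=
  [/\ forall j, maxset (run t xi) (I j),
      forall i, exists j, i \in I j
    & forall j j' : 'I_k.+1, (j < j')%N ->
        forall i i' : 'I_n, i \in I j -> i' \in I j' -> (i < i')%N].

End Chambers.

Section Decompositions.
Context {d n k : nat}.
Variable I : 'I_k.+1 -> {set 'I_n}.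
Implicit Types (A S : {set 'I_n}).

Definition is_first A (i : 'I_n) : bool :=
  (i \in A) && [forall l in A, (i <= l)%N].

Definition is_last A (i : 'I_n) : bool :=
  (i \in A) && [forall l in A, (l <= i)%N].

Definition consecutive_pair (B : {set 'I_n}) : Prop :=
  exists (j : 'I_k.+1) (x y : 'I_n),
    [/\ x \in I j, y \in I j, (x < y)%N,
        forall l, l \in I j -> ~~ (x < l < y)%N
      & B = [set x; y]%SET].

Definition condS1 (S1 : {set 'I_n}) : Prop :=
  exists s : 'I_k -> 'I_n,
    [/\ injective s, S1 = [set s j | j : 'I_k]%SET
      & forall j : 'I_k, is_last (I (widen_ord (leqnSn k) j)) (s j)
                      \/ is_first (I (lift ord0 j)) (s j)].

Definition condS2 (S2 : {set 'I_n}) : Prop :=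
  (exists a b : 'I_n,
     [/\ is_first (I ord0) a, is_last (I ord_max) b
       & S2 \in [:: finset.set0; [set a]%SET; [set b]%SET; [set a; b]%SET]])
  /\ ~~ odd (d - k - #|S2|).

(* [finset.partition] makes the pairs in [Q] pairwise disjoint with union [S3]. *)
Definition condS3 (S2 S3 : {set 'I_n}) : Prop :=
  #|S3| = (d - k - #|S2|)%N /\
  exists Q : {set {set 'I_n}},
    [/\ finset.partition Q S3, #|Q| = ((d - k - #|S2|)./2)%N
      & forall B, B \in Q -> consecutive_pair B].

(* When #|S| = d, the disjointness and cardinality conditions force
   k + #|S2| <= d, so the subtractions [d - k - #|S2|] are not truncated. *)
Definition facet_decomposition (S S1 S2 S3 : {set 'I_n}) : Prop :=
  [/\ S = S1 :|: S2 :|: S3,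
      [&& [disjoint S1 & S2], [disjoint S1 & S3] & [disjoint S2 & S3]],
      condS1 S1, condS2 S2 & condS3 S2 S3].

End Decompositions.

Arguments condS2 d {n k} I S2.
Arguments condS3 d {n k} I S2 S3.
Arguments facet_decomposition d {n k} I S S1 S2 S3.

(* Main.v *)
(* On the hyperplane [dot xi x = 1], an affine function is [dot g] for some g, and its value at
   [point t xi i] is q_g(t_i) / q_xi(t_i).  A facet with vertex set indexed by S, |S| = d, hence
   forces q_g to be a multiple of prod_(s in S) (x - t_s), so S gives a facet iff this product
   times q_xi has constant sign on T \ S (Gale's evenness).  As q_xi alternates in sign from block
   to block, this says that #{s in S | s < i} + (block of i) has constant parity e for i not in S.
   The parity of #S below the cut between two blocks decides which side of the cut lies in S1, and
   e decides whether t_(1,1) lies in S2; in the remaining set S3 the number of elements below any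
   block boundary or any i not in S3 is even, so pairing consecutive elements works. *)
Require Import Defs.
From mathcomp Require Import all_boot zify.

Set Implicit Arguments.
Unset Strict Implicit.
Unset Printing Implicit Defensive.

Section Counting.
Context {n : nat}.
Implicit Types (A B S : {set 'I_n}) (i : 'I_n) (p : nat).

Definition count_below A p : nat := \sum_(s in A) (s < p).

Lemma count_belowU A B p : [disjoint A & B] ->
  count_below (A :|: B) p = count_below A p + count_below B p.
Proof.
by move=> dAB; rewrite /count_below (eq_bigl [predU A & B]) ?bigU // => i; rewrite !inE.
Qed.

Lemma count_below_all A p : n <= p -> count_below A p = #|A|.
Proof.
move=> np; rewrite /count_below -sum1_card; apply: eq_bigr => i _.
by rewrite (leq_trans (ltn_ord i) np).
Qed.

Lemma count_belowS A i :
  count_below A i.+1 = count_below A i + (i \in A).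
Proof.
rewrite /count_below (eq_bigr (fun s : 'I_n => (s < i) + (s == i))); last first.
  by move=> l _; rewrite -val_eqE /= ltnS leq_eqVlt; case: ltngtP.
rewrite big_split /=; congr (_ + _).
rewrite -big_mkcondr /= sum1_card.
rewrite (eq_card (B := [pred l | (l == i) && (i \in A)])).
  by case: (i \in A); [rewrite (eq_card (B := pred1 i)) ?card1 // | rewrite eq_card0 //] => l;
    rewrite !inE ?andbT ?andbF.
by move=> l; rewrite unfold_in !inE; case: eqP => [->|_]; rewrite ?andbT ?andbF.
Qed.

Lemma sum_ord_lt k m : m <= k -> \sum_(j < k) (j < m) = m.
Proof.
move=> mk; rewrite -[RHS](card_ord m) -sum1_card.
by rewrite (big_ord_widen k (fun=> 1)) // [RHS]big_mkcond /=; apply: eq_bigr => j _; case: ltnP.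
Qed.

Lemma mem_down_closed A : (forall i i' : 'I_n, i <= i' -> i' \in A -> i \in A) ->
  forall i, (i \in A) = (i < #|A|).
Proof.
move=> dcA i.
have cle (l : nat) : #|[set x : 'I_n | x < l]| = minn n l.
  rewrite -sum1_card big_mkcond /=.
  rewrite (eq_bigr (fun x : 'I_n => nat_of_bool (x < minn n l))); last first.
    by move=> x _; rewrite inE leq_min ltn_ord; case: ltnP.
  by rewrite sum_ord_lt // geq_minl.
have sub l : l \in A -> l < #|A|.
  move=> lA; have : [set x : 'I_n | x < l.+1] \subset A.
    by apply/subsetP => x; rewrite inE ltnS => xl; exact: dcA lA.
  by move/subset_leq_card; rewrite cle (minn_idPr (ltn_ord l)).
suff {1}-> : A = [set x : 'I_n | x < #|A|] by rewrite inE.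
apply/eqP; rewrite eqEcard cle geq_minr andbT.
by apply/subsetP => x xA; rewrite inE sub.
Qed.

End Counting.

Section Blocks.
Context {n k : nat} (blk : 'I_n -> 'I_k.+1) (I : 'I_k.+1 -> {set 'I_n}).
Hypothesis blk_mono : forall i i' : 'I_n, i <= i' -> blk i <= blk i'.
Hypothesis blk_surj : forall j, exists i, blk i = j.
Hypothesis memI : forall j i, (i \in I j) = (blk i == j).
Implicit Types (S : {set 'I_n}) (i : 'I_n).

Definition block_start (j : nat) : nat := #|[set i | blk i < j]|.

Lemma lt_block_start i j : (i < block_start j) = (blk i < j).
Proof.
rewrite -mem_down_closed ?inE // => l l' ll'; rewrite !inE.
exact/leq_ltn_trans/blk_mono.
Qed.

Lemma block_start0 : block_start 0 = 0.
Proof. by apply/eqP; rewrite cards_eq0; apply/eqP/setP => i; rewrite !inE. Qed.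

Lemma block_startn : block_start k.+1 = n.
Proof.
rewrite -[RHS](card_ord n) -cardsT; congr #|pred_of_set _|.
by apply/setP => i; rewrite !inE ltn_ord.
Qed.

Lemma block_start_lt j j' : j < j' <= k.+1 -> block_start j < block_start j'.
Proof.
case/andP => jj' j'k; have [i bi] := blk_surj (Ordinal (leq_trans jj' j'k)).
apply: (@leq_ltn_trans i); last by rewrite lt_block_start bi.
by rewrite leqNgt lt_block_start bi ltnn.
Qed.

Lemma block_start_le j j' : j <= j' -> block_start j <= block_start j'.
Proof.
move=> jj'; apply: subset_leq_card; apply/subsetP => i; rewrite !inE.
by move/leq_trans; exact.
Qed.

Lemma block_startP i (j : 'I_k.+1) :
  (i \in I j) = (block_start j <= i < block_start j.+1).
Proof.
by rewrite memI leqNgt !lt_block_start -leqNgt ltnS -eqn_leq eq_sym.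
Qed.

Lemma is_firstE (j : 'I_k.+1) i :
  is_first (I j) i = (i == block_start j :> nat).
Proof.
have jlt : block_start j < block_start j.+1.
  by apply: block_start_lt; rewrite ltnSn ltn_ord.
apply/andP/eqP => [[]|ij].
  rewrite block_startP => /andP[ji ij] /forallP fi.
  have fn : block_start j < n by apply: leq_ltn_trans ji _.
  have := fi (Ordinal fn); rewrite block_startP /= leqnn jlt /=.
  lia.
split; first by rewrite block_startP ij leqnn.
apply/forallP => l; apply/implyP; rewrite block_startP; lia.
Qed.

Lemma is_lastE (j : 'I_k.+1) i :
  is_last (I j) i = (i.+1 == block_start j.+1 :> nat).
Proof.
have jlt : block_start j < block_start j.+1.
  by apply: block_start_lt; rewrite ltnSn ltn_ord.
have jn : block_start j.+1 <= n.
  by rewrite -block_startn; apply: block_start_le.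
apply/andP/eqP => [[]|ij].
  rewrite block_startP => /andP[ji ij] /forallP fi.
  have fn : (block_start j.+1).-1 < n by lia.
  have := fi (Ordinal fn); rewrite block_startP /=.
  lia.
split; first by rewrite block_startP; lia.
apply/forallP => l; apply/implyP; rewrite block_startP; lia.
Qed.

(* No pair straddles the cut before position [p], as [p] is not in [S] or starts a block. *)
Lemma count_below_pairs S Q p :
  partition Q S -> (forall B, B \in Q -> consecutive_pair I B) ->
  (forall i, i \in S -> i = p :> nat -> i = block_start (blk i) :> nat) ->
  ~~ odd (count_below S p).
Proof.
move=> pQ cQ Sp; rewrite /count_below (set_partition_big _ pQ) /=.
apply: (big_ind (fun m => ~~ odd m)) => //.
  by move=> a b; rewrite oddD => /negbTE-> /negbTE->.
move=> B BQ; have [j [x [y [xj yj xy nxy eB]]]] := cQ _ BQ.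
have yS : y \in S.
  by rewrite -(cover_partition pQ); apply/bigcupP; exists B; rewrite // eB !inE eqxx orbT.
rewrite eB big_setU1 ?big_set1 /=; last by rewrite inE -val_eqE /= neq_ltn xy.
suff -> : (x < p) = (y < p) by rewrite addnn odd_double.
apply/idP/idP; last lia.
move=> xp; rewrite ltnNge; apply/negP => py.
have [yp|yp] := eqVneq (y : nat) p.
  have /eqP by_ : blk y == j by rewrite -memI.
  have := Sp _ yS yp; rewrite by_; move: xj; rewrite block_startP; lia.
have pn : p < n by have := ltn_ord y; lia.
have pj : Ordinal pn \in I j by move: xj yj; rewrite !block_startP /=; lia.
by have := nxy _ pj; rewrite /=; lia.
Qed.

Section Separators.
Context (s : 'I_k -> 'I_n).
Hypothesis s_inj : injective s.
Hypothesis sP : forall j : 'I_k, is_last (I (widen_ord (leqnSn k) j)) (s j)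
                      \/ is_first (I (lift ord0 j)) (s j).
Let S1 := [set s j | j : 'I_k].

Lemma separatorP (j : 'I_k) : (s j).+1 = block_start j.+1 \/ s j = block_start j.+1 :> nat.
Proof.
by have [] := sP j; rewrite ?is_lastE ?is_firstE /= => /eqP; [left|right].
Qed.

Lemma count_below_separators p : count_below S1 p = \sum_(j < k) (s j < p).
Proof. by rewrite /count_below big_imset //= => x y _ _ /s_inj. Qed.

Lemma count_below_separators_notin i : i \notin S1 -> count_below S1 i = blk i.
Proof.
move=> iS; rewrite count_below_separators -[RHS](@sum_ord_lt k); last first.
  by rewrite -ltnS ltn_ord.
apply: eq_bigr => j _; congr nat_of_bool.
have sji : s j != i :> nat.
  by apply: contraNneq iS => /val_inj <-; exact: imset_f.
have := lt_block_start i j.+1; rewrite ltnS.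
by have := separatorP j; case: leqP; case: ltnP; lia.
Qed.

Lemma count_below_separators_start (j : 'I_k) :
  count_below S1 (block_start j.+1) = j + ((s j).+1 == block_start j.+1).
Proof.
have jk := ltn_ord j.
rewrite count_below_separators (bigD1 j) //= addnC; congr (_ + _); last first.
  by congr nat_of_bool; have := separatorP j; lia.
transitivity (\sum_(l < k) (l < j)); last by rewrite sum_ord_lt // ltnW.
rewrite [RHS](bigD1 j) //= ltnn add0n; apply: eq_bigr => l; rewrite -val_eqE /= => lj.
congr nat_of_bool; have := separatorP l; have lk := ltn_ord l.
have [ll|ll] := ltnP l j.
  have := @block_start_lt l.+1 j.+1; lia.
have := @block_start_lt j.+1 l.+1; lia.
Qed.

End Separators.

Lemma mem_blockP i (j : nat) : j <= k -> block_start j <= i < block_start j.+1 -> blk i = j :> nat.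
Proof.
by move=> jk; rewrite leqNgt !lt_block_start; lia.
Qed.

Lemma count_below_ends S (a b : 'I_n) p :
  a = 0 :> nat -> b.+1 = n -> 1 < n ->
  S \in [:: set0; [set a]; [set b]; [set a; b]] ->
  count_below S p = (a \in S) * (0 < p) + (b \in S) * (n <= p).
Proof.
move=> a0 bn n1; have ab : a != b by rewrite -val_eqE /=; lia.
have -> : (0 < p) = (a < p) by rewrite a0.
have -> : (n <= p) = (b < p) by lia.
rewrite !inE /count_below => /or4P[] /eqP->.
- by rewrite big_set0 !inE.
- by rewrite big_set1 !inE eqxx [b == a]eq_sym (negbTE ab) mul1n addn0.
- by rewrite big_set1 !inE eqxx (negbTE ab) mul1n.
- by rewrite big_setU1 ?inE // big_set1 !eqxx orbT !mul1n.
Qed.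

Lemma facet_decomposition_parity d S S1 S2 S3 (a b : 'I_n) :
  a = 0 :> nat -> b.+1 = n -> 1 < n -> #|S| = d ->
  facet_decomposition d I S S1 S2 S3 ->
  [/\ S2 \subset [set a; b],
      odd (d + k) = (a \in S2) (+) (b \in S2),
      forall i, i \notin S -> odd (count_below S i + blk i) = (a \in S2)
    & exists2 s : 'I_k -> 'I_n, S1 = [set s j | j : 'I_k] &
        forall j, s j = block_start j.+1
          - odd (count_below S (block_start j.+1) + j + (a \in S2)) :> nat].
Proof.
move=> a0 bn n1 cS [eS /and3P[d12 d13 d23] [s [s_inj eS1 sP]] [] [a' [b' [fa lb S2ab]]] ev2].
case=> cS3 [Q [pQ cQ consQ]].
have ea : a' = a by apply: val_inj; move: fa; rewrite is_firstE block_start0 => /eqP /= ->.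
have eb : b' = b.
  by apply: val_inj; move: lb; rewrite is_lastE block_startn => /eqP /=; lia.
rewrite {}ea {}eb in fa lb S2ab.
have cSp p : count_below S p = count_below S1 p + count_below S2 p + count_below S3 p.
  rewrite eS !count_belowU //.
  rewrite -setI_eq0 setIUl; move: d13 d23; rewrite -!setI_eq0 => /eqP-> /eqP->.
  by rewrite setU0.
have c2 p := count_below_ends p a0 bn n1 S2ab.
have cS1 : #|S1| = k by rewrite eS1 card_imset // card_ord.
have cS2 : #|S2| = (a \in S2) + (b \in S2).
  by rewrite -(@count_below_all _ _ n) // c2 leqnn (ltnW n1) !muln1.
split.
- by move: S2ab; rewrite !inE => /or4P[] /eqP->;
    rewrite ?sub0set ?sub1set ?subxx ?inE ?eqxx ?orbT.
- have := cSp n; rewrite !count_below_all // cS cS1 cS3 => e.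
  move: (d - k - #|S2|) ev2 e => m; rewrite cS2 => em ->.
  by rewrite !oddD (negbTE em) !oddb addbF addbC addbA addbb.
- move=> i iS; have iS1 : i \notin S1 by apply: contra iS => H; rewrite eS !inE H.
  have iS2 : i \notin S2 by apply: contra iS => H; rewrite eS !inE H orbT.
  have iS3 : i \notin S3 by apply: contra iS => H; rewrite eS !inE H orbT.
  rewrite cSp c2 eS1 (count_below_separators_notin s_inj sP) -?eS1 //.
  have := @count_below_pairs S3 Q i pQ consQ.
  have -> : (a \in S2) * (0 < i) = (a \in S2).
    case: posnP => [i0|_]; rewrite ?muln1 // muln0.
    suff -> : a = i by rewrite (negbTE iS2).
    by apply: val_inj; rewrite /= a0.
  have := ltn_ord i; case: leqP => // _ _; rewrite muln0.
  move=> H; have {}H : ~~ odd (count_below S3 i).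
    by apply: H => l lS3 /val_inj li; rewrite -li lS3 in iS3.
  by rewrite addn0 !oddD (negbTE H) addbF addbC addbA addbb oddb.
- exists s => // j; have := separatorP sP j.
  rewrite cSp c2 {1}eS1 (count_below_separators_start s_inj sP).
  have b0 : 0 < block_start j.+1.
    by rewrite -[X in X < _]block_start0; apply: block_start_lt; rewrite ltn0Sn ltnW // ltnS.
  have b1 : block_start j.+1 < n.
    by rewrite -[X in _ < X]block_startn; apply: block_start_lt; rewrite ltnS ltn_ord /=.
  have := @count_below_pairs S3 Q (block_start j.+1) pQ consQ.
  move=> H; have {H} : ~~ odd (count_below S3 (block_start j.+1)).
    apply: H => l lS3 lj; rewrite lj.
    have -> // : blk l = j.+1 :> nat.
    apply: mem_blockP; rewrite // lj leqnn.
    by apply: block_start_lt; rewrite ltnSn ltnS /=.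
  rewrite b0 leqNgt b1 muln0 addn0 muln1 !oddD => /negbTE->; rewrite addbF !oddb.
  by case: (odd j); case: (a \in S2) => -[<-|->];
    rewrite ?eqxx ?(gtn_eqF (ltnSn _)) /= ?subn1 ?subn0.
Qed.

Lemma facet_decomposition_unique d S S1 S2 S3 S1' S2' S3' :
  1 < n -> #|S| = d -> d < n ->
  facet_decomposition d I S S1 S2 S3 -> facet_decomposition d I S S1' S2' S3' ->
  [/\ S1 = S1', S2 = S2' & S3 = S3'].
Proof.
move=> n1 cS dn dec dec'.
have bn : n.-1 < n by lia.
pose a := Ordinal (ltnW n1); pose b := Ordinal bn.
have [||S2ab par2 parS [s eS1 sE]] // :=
    @facet_decomposition_parity _ _ _ _ _ a b _ _ n1 cS dec.
  by rewrite /=; lia.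
have [||S2ab' par2' parS' [s' eS1' sE']] // :=
    @facet_decomposition_parity _ _ _ _ _ a b _ _ n1 cS dec'.
  by rewrite /=; lia.
have [i iS] : exists i, i \notin S.
  apply/existsP; apply: contraTT dn => /existsPn SA; rewrite -leqNgt -cS.
  rewrite -[X in X <= _](card_ord n) -cardsT; apply: subset_leq_card.
  by apply/subsetP => i _; have := SA i; rewrite negbK.
have ea : (a \in S2) = (a \in S2') by rewrite -(parS _ iS) -(parS' _ iS).
have eb : (b \in S2) = (b \in S2') by move: par2; rewrite par2' ea; do 3 case: (_ \in _).
have e2 : S2 = S2'.
  apply/setP => l; have [lab|lab] := boolP (l \in [set a; b]).
    by move: lab; rewrite !inE => /orP[] /eqP->.
  have /negbTE-> : l \notin S2 by apply: contra lab; apply/subsetP.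
  by apply/esym/negbTE; apply: contra lab; apply/subsetP.
have e1 : S1 = S1'.
  rewrite eS1 eS1'; apply: eq_imset => j; apply: val_inj => /=.
  by rewrite sE sE' ea.
split=> //.
case: dec => eS /and3P[d12 d13 d23] _ _ _; case: dec' => eS' /and3P[d12' d13' d23'] _ _ _.
have diff (A B C : {set 'I_n}) : [disjoint A & C] -> [disjoint B & C] ->
    C = (A :|: B :|: C) :\: (A :|: B).
  move=> /disjointFl AC /disjointFl BC; apply/setP => l; rewrite !inE.
  by have := AC l; have := BC l; case: (l \in C) => [->// ->|_ _]//; rewrite orbF andNb.
by rewrite (diff S1 S2 S3) // (diff S1' S2' S3') // -eS -eS' e1 e2.
Qed.

Lemma pairs_of_even_count S :
  ~~ odd #|S| -> (forall i, i \notin S -> ~~ odd (count_below S i)) ->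
  (forall j, ~~ odd (count_below S (block_start j))) ->
  exists Q, [/\ partition Q S, #|Q| = #|S|./2 & forall B, B \in Q -> consecutive_pair I B].
Proof.
move=> evS evN evB.
(* The element [x] is paired with its predecessor when [odd (c x)]. *)
pose c := count_below S; pose f (x : 'I_n) : nat := x - odd (c x).
have cS (x : 'I_n) : c x.+1 = c x + (x \in S) by exact: count_belowS.
have pair x : x \in S -> exists y z : 'I_n,
    [/\ z = y.+1 :> nat, y \in S /\ z \in S, ~~ odd (c y), odd (c z) & f x = y].
  move=> xS; have next y : y \in S -> ~~ odd (c y) ->
      exists z : 'I_n, [/\ z = y.+1 :> nat, z \in S & odd (c z)].
    move=> yS evy; have ody : odd (c y.+1) by rewrite cS yS addn1.
    have yn : y.+1 < n.
      rewrite ltn_neqAle ltn_ord andbT; apply: contraL ody => /eqP->.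
      by rewrite /c count_below_all.
    exists (Ordinal yn); split=> //; apply: contraLR ody => /evN; exact.
  have [odx|evx] := boolP (odd (c x)); last first.
    have [z [zx zS odz]] := next x xS evx; exists x, z; split=> //.
    by rewrite /f (negbTE evx) subn0.
  have x0 : 0 < x.
    rewrite lt0n; apply: contraL odx => /eqP->.
    by rewrite /c /count_below big1.
  have yn : x.-1 < n by have := ltn_ord x; lia.
  have xE : x = (Ordinal yn).+1 :> nat by rewrite /= prednK.
  have cx := cS (Ordinal yn); rewrite -xE in cx.
  have [yS|yS] := boolP (Ordinal yn \in S); last first.
    by move: odx; rewrite cx (negbTE yS) addn0 (negbTE (evN _ yS)).
  exists (Ordinal yn), x; split=> //; last by rewrite /f odx subn1.
  by move: odx; rewrite cx yS addn1.
have uniq_pair (x y : 'I_n) : f x = f y -> odd (c x) = odd (c y) -> x \in S -> y \in S -> x = y.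
  move=> + e xS yS; rewrite /f e => fxy; apply: val_inj => /=.
  have pos (z : 'I_n) : odd (c z) -> 0 < z.
    by move=> oz; rewrite lt0n; apply: contraL oz => /eqP->; rewrite /c /count_below big1.
  case: (boolP (odd (c y))) fxy => [oy|_]; last by rewrite !subn0.
  by have := pos _ oy; have := pos x; rewrite e oy => /(_ isT); lia.
have consQ B : B \in preim_partition f S -> consecutive_pair I B.
  case/imsetP => x xS ->; have [y [z [zy [yS zS] ey oz fx]]] := pair x xS.
  have fy : f y = y by rewrite /f (negbTE ey) subn0.
  have fz : f z = y by rewrite /f oz zy subn1.
  exists (blk y), y, z; split.
  - by rewrite memI.
  - rewrite block_startP; apply/andP; split.
      rewrite zy leqW // leqNgt lt_block_start ltnn //.
    rewrite ltn_neqAle zy lt_block_start ltnSn andbT.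
    apply: contraL oz => /eqP e; rewrite zy e; exact: evB.
  - by rewrite zy.
  - by move=> l _; lia.
  - apply/setP => l; rewrite !inE fx; apply/andP/orP => [[lS /eqP fl]|[]/eqP->]; last 2 first.
    + by rewrite yS fy.
    + by rewrite zS fz.
    have [ol|el] := boolP (odd (c l)); [right|left]; apply/eqP; apply: uniq_pair => //.
    + by rewrite fz fl.
    + by rewrite oz ol.
    + by rewrite fy fl.
    + by rewrite (negbTE ey) (negbTE el).
exists (preim_partition f S); split=> //; first exact: preim_partitionP.
rewrite (@card_uniform_partition _ 2 _ S _ (preim_partitionP f S)) ?mulnK ?muln2 ?doubleK //.
move=> B /consQ[j [x [y [_ _ xy _ ->]]]]; rewrite cards2.
by rewrite -val_eqE /= neq_ltn xy.
Qed.

Lemma facet_decomposition_exists d S (e : bool) :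
  1 < n -> #|S| = d ->
  (forall i, i \notin S -> odd (count_below S i + blk i) = e) ->
  exists S1 S2 S3, facet_decomposition d I S S1 S2 S3.
Proof.
move=> n1 cS altS.
have bn : n.-1 < n by lia.
pose a := Ordinal (ltnW n1); pose b := Ordinal bn.
have a0 : a = 0 :> nat by []. have bE : b.+1 = n by rewrite /= prednK // ltnW.
pose c := count_below S; have cSS (x : 'I_n) : c x.+1 = c x + (x \in S) by exact: count_belowS.
have start0 (j : 'I_k) : 0 < block_start j.+1.
  by rewrite -[X in X < _]block_start0; apply: block_start_lt; rewrite ltn0Sn ltnW // ltnS.
have startn (j : 'I_k) : block_start j.+1 < n.
  by rewrite -[X in _ < X]block_startn; apply: block_start_lt; rewrite ltnS ltn_ord /=.
pose isl (j : 'I_k) := odd (c (block_start j.+1) + j) (+) e.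
have sn (j : 'I_k) : block_start j.+1 - isl j < n by exact: leq_ltn_trans (leq_subr _ _) (startn j).
pose s (j : 'I_k) := Ordinal (sn j).
have sl (j : 'I_k) : isl j -> (s j).+1 = block_start j.+1.
  by move=> lj; rewrite /s /= lj subn1 prednK.
have sf (j : 'I_k) : ~~ isl j -> s j = block_start j.+1 :> nat.
  by move=> lj; rewrite /s /= (negbTE lj) subn0.
have blk_sl (j : 'I_k) : isl j -> blk (s j) = j :> nat.
  move=> lj; have := sl j lj; have := @block_start_lt j j.+1; have := ltn_ord j.
  by move=> jk jlt sj; apply: mem_blockP; lia.
have blk_sf (j : 'I_k) : ~~ isl j -> blk (s j) = j.+1 :> nat.
  move=> lj; have := sf j lj; have := @block_start_lt j.+1 j.+2; have := ltn_ord j.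
  by move=> jk jlt sj; apply: mem_blockP; lia.
have sS (j : 'I_k) : s j \in S.
  apply/negPn/negP => sjS; have := altS _ sjS; rewrite -/c.
  have [lj|lj] := boolP (isl j).
    have := cSS (s j); rewrite (sl _ lj) (negbTE sjS) addn0 blk_sl // => <-.
    by move: lj; rewrite /isl => /[swap] ->; rewrite addbb.
  rewrite blk_sf // sf // addnS /=; move: lj; rewrite /isl => /[swap] <-.
  by rewrite addbN addbb.
have s_inj : injective s.
  suff lt_neq (j l : 'I_k) : j < l -> s j <> s l.
    move=> j l sjl; apply: val_inj; case: (ltngtP j l) => // /lt_neq; first by case.
    by case.
  move=> jl sjl; have jk := ltn_ord j; have lk := ltn_ord l.
  have := @block_start_lt j.+1 l.+1; rewrite ltnS jl ltnS ltnW // => /(_ isT) bjl.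
  have sjl' : s j = s l :> nat by rewrite sjl.
  have jf : ~~ isl j by apply/negP => /sl; case: (boolP (isl l)) => [/sl|/sf]; lia.
  have ll : isl l by apply/negPn/negP => /sf; have := sf _ jf; lia.
  have := blk_sf _ jf; rewrite sjl blk_sl // => lj.
  have sll := sl l ll; have sfj := sf j jf.
  move: jf ll; rewrite /isl -sll cSS sS -sfj sjl lj.
  by rewrite addn1 addnS /=; case: odd; case: (e).
pose S1 := [set s j | j : 'I_k].
pose e' := odd (d + k) (+) e.
pose S2 := [set i : 'I_n | (i == a) && e || (i == b) && e'].
have ab : (a == b) = false by apply/negbTE; rewrite -val_eqE /=; lia.
have aS2 : (a \in S2) = e by rewrite inE eqxx ab /= orbF.
have bS2 : (b \in S2) = e' by rewrite inE eqxx [b == a]eq_sym ab.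
have S2ab : S2 \in [:: set0; [set a]; [set b]; [set a; b]].
  suff H (u v : bool) : [set i : 'I_n | (i == a) && u || (i == b) && v]
      \in [:: set0; [set a]; [set b]; [set a; b]] by exact: H.
  rewrite !inE; apply/or4P; case: u v => -[]; [apply: Or44|apply: Or42|apply: Or43|apply: Or41];
    by apply/eqP/setP => i; rewrite !inE ?andbT ?andbF ?orbF.
have c0 (A : {set 'I_n}) : count_below A 0 = 0 by rewrite /count_below big1.
have cn (A : {set 'I_n}) : count_below A n = #|A|. by rewrite count_below_all.
have blka : blk a = 0 :> nat.
  by apply: mem_blockP => //; rewrite block_start0 -[X in X < _]block_start0 block_start_lt.
have blkb : blk b = k :> nat.
  apply: mem_blockP => //; rewrite block_startn bE leqnn andbT -ltnS bE.
  by rewrite -[X in _ < X]block_startn block_start_lt // !leqnn.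
have S2S : S2 \subset S.
  apply/subsetP => i; rewrite inE => /orP[/andP[/eqP-> he]|/andP[/eqP-> he]].
    by apply: contraTT he => aS; rewrite -(altS a aS) c0 blka.
  apply: contraTT he => bS; rewrite /e' -(altS b bS) blkb.
  by have := cSS b; rewrite bE (negbTE bS) addn0 /c cn cS => <-; rewrite addbb.
have S1S : S1 \subset S by apply/subsetP => i /imsetP[j _ ->].
have d12 : [disjoint S1 & S2].
  apply/pred0P => i /=; apply/negP => /andP[/imsetP[j _ ->]].
  rewrite inE => /orP[/andP[/eqP sja he]|/andP[/eqP sjb he]].
    have lj : isl j.
      by apply/negPn/negP => /sf; rewrite sja a0 => j0; have := start0 j; rewrite -j0.
    have j0 := blk_sl _ lj; rewrite sja blka in j0.
    move: (lj); rewrite /isl -(sl _ lj) sja cSS a0 /c c0 -j0 he.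
    by rewrite -[a]sja sS.
  have lj : ~~ isl j.
    by apply/negP => /sl; rewrite sjb bE => j0; have := startn j; rewrite -j0 ltnn.
  have jk := blk_sf _ lj; rewrite sjb blkb in jk.
  have := cSS b; rewrite -[b in b \in S]sjb sS bE /c cn cS => dE.
  have ok : odd k = ~~ odd j := congr1 odd jk.
  move: (lj) he; rewrite /isl /e' -(sf _ lj) sjb dE /c !oddD ok /=.
  by case: odd; case: odd; case: (e).
pose S3 := S :\: (S1 :|: S2).
have d123 : [disjoint S1 :|: S2 & S3].
  by rewrite disjoint_sym disjoints_subset subsetDr.
have eS : S = S1 :|: S2 :|: S3.
  by rewrite /S3 setDE setUIr setUCr setIT; apply/esym/setUidPr; rewrite subUset S1S.
have cSp p : count_below S p = count_below S1 p + count_below S2 p + count_below S3 p.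
  by rewrite {1}eS !count_belowU.
have c2 p := count_below_ends p a0 bE n1 S2ab.
have cS1 : #|S1| = k by rewrite card_imset // card_ord.
have cS2 : #|S2| = e + e' by rewrite -cn c2 leqnn (ltnW n1) !muln1 aS2 bS2.
have dE : d = k + #|S2| + #|S3| by rewrite -cS -cS1 -!cn -cSp.
have cS3 : #|S3| = d - k - #|S2| by rewrite {1}dE -addnA !addKn.
have ev3 : ~~ odd #|S3|.
  have := erefl e'; rewrite {2}/e' {1}dE cS2 !oddD !oddb.
  by case: (odd k); case: (odd #|S3|); case: (e); case: (e').
have sP (j : 'I_k) : is_last (I (widen_ord (leqnSn k) j)) (s j) \/ is_first (I (lift ord0 j)) (s j).
  have [lj|lj] := boolP (isl j); [left|right]; first by rewrite is_lastE (sl _ lj).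
  by rewrite is_firstE (sf _ lj).
have evB j : ~~ odd (count_below S3 (block_start j)).
  case: j => [|j]; first by rewrite block_start0 c0.
  have [jk|jk] := ltnP j k; last first.
    by rewrite count_below_all // -[X in X <= _]block_startn; apply: block_start_le.
  pose j' := Ordinal jk; have := cSp (block_start j'.+1).
  rewrite c2 aS2 start0 leqNgt startn muln0 addn0 muln1 (count_below_separators_start s_inj sP).
  have -> : ((s j').+1 == block_start j'.+1) = isl j'.
    by case: (boolP (isl j')) => [/sl/eqP|/sf->]//; rewrite gtn_eqF.
  move=> /(congr1 odd); rewrite -/c /isl !oddD !oddb -/j'.
  by case: (odd (c _)); case: (odd j'); case: (e); case: (odd _).
have evN i : i \notin S3 -> ~~ odd (count_below S3 i).
  move=> iS3.
  have cS3S : count_below S3 i.+1 = count_below S3 i by rewrite count_belowS (negbTE iS3) addn0.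
  have [|iS1] := boolP (i \in S1).
    case/imsetP => j _ ij; rewrite ij; rewrite ij in cS3S.
    by case: (boolP (isl j)) => [/sl e1|/sf->]//; rewrite -cS3S e1.
  have [|iS2] := boolP (i \in S2).
    rewrite inE => /orP[] /andP[/eqP ie _]; first by rewrite ie c0.
    by rewrite -cS3S ie bE cn.
  have iS : i \notin S by apply: contra iS3 => iS; rewrite in_setD in_setU negb_or iS1 iS2.
  have := altS i iS; rewrite cSp c2 aS2 (count_below_separators_notin s_inj sP) //.
  have -> : e * (0 < i) = e.
    case: posnP => [i0|_]; rewrite ?muln1 // muln0.
    have ai : a = i by apply: val_inj; rewrite /= i0.
    by rewrite -aS2 ai (negbTE iS2).
  rewrite leqNgt ltn_ord muln0 addn0 !oddD !oddb.
  by case: (odd (blk i)); case: (e); case: (odd _).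
have [Q [pQ cQ consQ]] := pairs_of_even_count ev3 evN evB.
exists S1, S2, S3; split=> //.
- rewrite d12; move: d123; rewrite -!setI_eq0 setIUl setU_eq0 => /andP[-> ->] //.
- by exists s; split.
- split; last by rewrite -cS3.
  exists a, b; split=> //; first by rewrite is_firstE block_start0.
  by rewrite is_lastE block_startn bE.
- by split=> //; exists Q; rewrite -cS3.
Qed.

End Blocks.

From HB Require Import structures.
From mathcomp Require Import all_boot all_order all_algebra.
From mathcomp Require Import all_classical all_reals.
From mathcomp Require Import topology normedtype convex.
From mathcomp Require Import interval_inference.
Import Order.TTheory GRing.Theory Num.Theory.
Import numFieldNormedType.Exports.
Local Open Scope classical_set_scope.
Local Open Scope ring_scope.

Section Polytopes.
Context {R : realType} {N : nat}.
Implicit Types (X P F : set 'rV[R]_N) (c x : 'rV[R]_N).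

Fact dot_is_linear c : linear (dot c : 'rV[R]_N -> R^o).
Proof.
move=> a u v; rewrite /dot scaler_sumr -big_split /=; apply: eq_bigr => i _.
by rewrite !mxE mulrDr /GRing.scale /= mulrCA.
Qed.

HB.instance Definition _ c :=
  GRing.isLinear.Build R 'rV[R]_N R^o *:%R (dot c : 'rV[R]_N -> R^o) (dot_is_linear c).

Lemma dotZ c (a : R) x : dot c (a *: x) = a * dot c x.
Proof. exact: (linearZ_LR (dot c : 'rV[R]_N -> R^o)). Qed.

Lemma dotB c x y : dot c (x - y) = dot c x - dot c y.
Proof. exact: (linearB (dot c : 'rV[R]_N -> R^o)). Qed.

Lemma dotD c x y : dot c (x + y) = dot c x + dot c y.
Proof. exact: (linearD (dot c : 'rV[R]_N -> R^o)). Qed.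

Lemma dot_sum c (J : finType) (a : J -> R) (p : J -> 'rV[R]_N) :
  dot c (\sum_j a j *: p j) = \sum_j a j * dot c (p j).
Proof.
rewrite (linear_sum (dot c : 'rV[R]_N -> R^o)); apply: eq_bigr => j _.
exact: dotZ.
Qed.

Lemma mem_convex_hull n (p : 'I_n -> 'rV[R]_N) i : convex_hull (range p) (p i).
Proof. by move=> A [_ AX]; apply: AX; exists i. Qed.

Lemma convex_hull_range n (p : 'I_n -> 'rV[R]_N) x :
  convex_hull (range p) x ->
  exists a : 'I_n -> R, [/\ forall i, 0 <= a i, \sum_i a i = 1
    & x = \sum_i a i *: p i].
Proof.
pose C := [set x | exists a : 'I_n -> R, [/\ forall i, 0 <= a i, \sum_i a i = 1
    & x = \sum_i a i *: p i]].
suff CX : convex_hull (range p) `<=` C by move/CX.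
apply: smallest_sub; last first.
  move=> _ [i _ <-]; exists (fun j => (j == i)%:R); split.
  - by move=> j; rewrite ler0n.
  - by rewrite (bigD1 i) //= eqxx big1 ?addr0 // => j /negbTE->.
  - rewrite (bigD1 i) //= eqxx scale1r big1 ?addr0 // => j /negbTE->.
    by rewrite scale0r.
move=> u v l /set_mem[a [a0 a1 ->]] /set_mem[b [b0 b1 ->]]; apply/mem_set.
exists (fun i => l%:num * a i + (1 - l%:num) * b i); split.
- by move=> i; apply: addr_ge0; apply: mulr_ge0.
- by rewrite big_split /= -!mulr_sumr a1 b1 !mulr1 addrC subrK.
- transitivity (l%:num *: (\sum_i a i *: p i) + (1 - l%:num) *: (\sum_i b i *: p i)) => //.
  rewrite !scaler_sumr -big_split /=; apply: eq_bigr => i _.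
  by rewrite !scalerA -scalerDl.
Qed.

Lemma convex_comb_le (J : finType) (a f : J -> R) (b : R) :
  (forall i, 0 <= a i) -> \sum_i a i = 1 -> (forall i, a i != 0 -> f i <= b) ->
  \sum_i a i * f i <= b.
Proof.
move=> a0 a1 fb; rewrite -[b]mul1r -a1 mulr_suml; apply: ler_sum => i _.
have [->|/fb] := eqVneq (a i) 0; first by rewrite !mul0r.
exact: ler_wpM2l.
Qed.

Lemma convex_comb_eq (J : finType) (a f : J -> R) (b : R) :
  (forall i, 0 <= a i) -> \sum_i a i = 1 -> (forall i, a i != 0 -> f i <= b) ->
  \sum_i a i * f i = b -> forall i, a i != 0 -> f i = b.
Proof.
move=> a0 a1 fb e i ai.
have : \sum_i a i * (b - f i) = 0.
  under eq_bigr do rewrite mulrBr.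
  by rewrite sumrB -mulr_suml a1 mul1r e subrr.
move/psumr_eq0P => /(_ _ i isT)/eqP.
rewrite mulf_eq0 (negbTE ai) subr_eq0 eq_sym /= => H; apply/eqP/H => j _.
have [->|/fb fj] := eqVneq (a j) 0; first by rewrite mul0r.
by apply: mulr_ge0; rewrite ?subr_ge0.
Qed.

Lemma has_dim_uniq X m m' : has_dim X m -> has_dim X m' -> m = m'.
Proof.
move=> [x [U [e <-]]] [x' [U' [e' <-]]]; rewrite {}e in e'.
suff sub (y y' : 'rV[R]_N) (V V' : {vspace 'rV[R]_N}) :
    [set y + u | u in [set` V]] = [set y' + u | u in [set` V']] -> (V <= V')%VS.
  apply/eqP; rewrite eqn_leq (dimvS (sub _ _ _ _ e')).
  by rewrite (dimvS (sub _ _ _ _ (esym e'))).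
move=> eV; apply/subvP => v vV.
have [u' u'V eu] : [set y' + u | u in [set` V']] (y + v) by rewrite -eV; exists v.
have [u u0V e0] : [set y' + u | u in [set` V']] (y + 0).
  by rewrite -eV; exists 0 => //=; exact: mem0v.
have -> : v = u' - u.
  by apply: (addrI y); rewrite -eu -[y in RHS]addr0 -e0 addrACA subrr addr0.
exact: rpredB.
Qed.

(* On the span of [s], the affine hull of [X] is the affine hyperplane [dot c x = 1]. *)
Lemma has_dim_span X c (s : seq 'rV[R]_N) m :
  free s -> size s = m.+1 -> (forall v, v \in s -> X v) ->
  (forall x, X x -> x \in <<s>>%VS /\ dot c x = 1) -> has_dim X m.
Proof.
move=> fs ss sX Xs.
pose f := linfun (dot c : 'rV[R]_N -> R^o).
have fE x : f x = dot c x by rewrite lfunE.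
have s0 : (0 < size s)%N by rewrite ss.
pose x0 := s`_0; have x0s : x0 \in s by exact: mem_nth.
have [x0W x01] := Xs _ (sX _ x0s).
pose U := (<<s>> :&: lker f)%VS.
have dimU : (\dim U)%VS = m.
  apply/eqP; rewrite -(eqn_add2r 1) [(m + 1)%N]addn1 -ss -(eqnP fs).
  rewrite -(limg_ker_dim f <<s>>) eqn_add2l.
  rewrite eq_sym eqn_leq; apply/andP; split.
    by rewrite (leq_trans (dimvS (subvf _))) // dimvf.
  rewrite lt0n dimv_eq0; apply: contraTneq (memv_img f x0W) => ->.
  by rewrite memv0 fE x01 oner_eq0.
exists x0, U; split=> //; apply/seteqP; split=> y.
  case=> k [p [a [pX a1 ->]]]; exists (\sum_i a i *: p i - x0); last by rewrite addrC subrK.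
  rewrite /= memv_cap memv_ker fE dotB dot_sum x01 rpredB //=; last first.
    by apply: rpred_sum => i _; rewrite rpredZ //; case: (Xs _ (pX i)).
  by under eq_bigr do rewrite (Xs _ (pX _)).2 mulr1; rewrite a1 subrr.
case=> u /=; rewrite memv_cap memv_ker fE => /andP[uW /eqP u0] <-.
have yW : x0 + u \in <<in_tuple s>>%VS by exact: rpredD.
exists (size s), (fun i : 'I_(size s) => s`_i), (fun i => coord (in_tuple s) i (x0 + u)).
split; [by move=> i; apply/sX/mem_nth| |exact: coord_span].
have := congr1 (dot c) (coord_span yW); rewrite dotD x01 u0 addr0 dot_sum => ->.
by apply: eq_bigr => i _; rewrite (Xs _ (sX _ (mem_nth 0 (ltn_ord i)))).2 mulr1.
Qed.

End Polytopes.

Section Facets.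
Context {R : realType} {d n : nat} (t : 'I_n -> R) (xi : 'rV[R]_d.+1).
Hypothesis t_inj : injective t.
Hypothesis q_neq0 : forall i, q xi (t i) != 0.
Implicit Types (A S : {set 'I_n}) (i : 'I_n) (c : 'rV[R]_d.+1).

Lemma dot_point c i : dot c (Defs.point t xi i) = q c (t i) / q xi (t i).
Proof.
rewrite dotZ mulrC; congr (_ * _); apply: eq_bigr => j _.
by rewrite mxE.
Qed.

Lemma dot_point_self i : dot xi (Defs.point t xi i) = 1.
Proof. by rewrite dot_point divff. Qed.

Lemma q_rVpoly c x : q c x = (rVpoly c).[x].
Proof.
rewrite (@horner_coef_wide _ d.+1) ?size_poly //; apply: eq_bigr => i _.
by rewrite coef_rVpoly_ord.
Qed.

Definition node_poly A : {poly R} := \prod_(s in A) ('X - (t s)%:P).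

Lemma size_node_poly A : size (node_poly A) = #|A|.+1.
Proof. by rewrite /node_poly -big_enum size_prod_XsubC -cardE. Qed.

Lemma horner_node_poly A x : (node_poly A).[x] = \prod_(s in A) (x - t s).
Proof. by rewrite horner_prod; apply: eq_bigr => s _; rewrite hornerXsubC. Qed.

Lemma node_prod_eq0 A i : (\prod_(s in A) (t i - t s) == 0) = (i \in A).
Proof.
apply/prodf_eq0/idP => [[s sA]|iA]; last by exists i; rewrite ?subrr.
by rewrite subr_eq0 => /eqP/t_inj ->.
Qed.

Definition node_form A : 'rV[R]_d.+1 := poly_rV (node_poly A).

Lemma dot_node_form A i : (#|A| <= d)%N ->
  dot (node_form A) (Defs.point t xi i) = (\prod_(s in A) (t i - t s)) / q xi (t i).
Proof.
move=> Ad; rewrite dot_point q_rVpoly poly_rV_K ?size_node_poly //.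
by rewrite horner_node_poly.
Qed.

Lemma dot_node_form_eq0 A i : (#|A| <= d)%N ->
  (dot (node_form A) (Defs.point t xi i) == 0) = (i \in A).
Proof.
by move=> Ad; rewrite dot_node_form // mulf_eq0 invr_eq0 (negbTE (q_neq0 i)) orbF node_prod_eq0.
Qed.

Lemma points_free (s : seq 'I_n) : uniq s -> (size s <= d.+1)%N ->
  free [seq Defs.point t xi i | i <- s].
Proof.
move=> us sd; apply/(@freeP _ _ _ (in_tuple [seq Defs.point t xi i | i <- s])) => k k0 i.
have ltm (j : 'I_(size [seq Defs.point t xi i | i <- s])) : (j < size s)%N.
  by rewrite (leq_trans (ltn_ord j)) // size_map.
have i0 : 'I_n by case: (s) i => [[]|z].
pose r j := nth i0 s j; pose A := ([set z in s] :\ r i)%SET.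
have Ad : (#|A| <= d)%N.
  have ris : r i \in [set z in s]%SET by rewrite inE mem_nth.
  have := cardsD1 (r i) [set z in s]%SET; rewrite ris cardsE (card_uniqP us) => e.
  by rewrite -ltnS -[(_ < _)%N]/(1 + _ <= _)%N -e.
have := congr1 (dot (node_form A)) k0; rewrite dot_sum (bigD1 i) //= big1 => [|j ji].
  rewrite addr0 (nth_map i0) // -/(r i).
  have -> : dot (node_form A) 0 = 0 by rewrite -(subrr 0) dotB subrr.
  by move/eqP; rewrite mulf_eq0 dot_node_form_eq0 // !inE eqxx orbF => /eqP.
apply/eqP; rewrite mulf_eq0 (nth_map i0) // -/(r j) dot_node_form_eq0 // !inE mem_nth // andbT.
by rewrite nth_uniq // ji orbT.
Qed.

Lemma polytope_dim : (d < n)%N -> has_dim (polytope t xi) d.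
Proof.
move=> dn; pose s := take d.+1 (enum 'I_n).
have ss : size s = d.+1 by rewrite size_takel // -cardE card_ord.
have fs : free [seq Defs.point t xi i | i <- s].
  by rewrite points_free ?ss // take_uniq ?enum_uniq.
apply: (has_dim_span (c := xi) fs); rewrite ?size_map //.
  by move=> _ /mapP[i _ ->]; exact: mem_convex_hull.
move=> x /convex_hull_range[a [_ a1 ->]]; split; last first.
  by rewrite dot_sum -[RHS]a1; apply: eq_bigr => i _; rewrite dot_point_self mulr1.
suff -> : <<[seq Defs.point t xi i | i <- s]>>%VS = fullv by rewrite memvf.
by apply/eqP; rewrite eqEdim subvf (eqnP fs) size_map ss dimvf dim_matrix mul1r leqnn.
Qed.

Section FacetOfAlternating.
Context (S : {set 'I_n}) (c : 'rV[R]_d.+1).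
Hypothesis cardS : #|S| = d.
Hypothesis c_le0 : forall i, dot c (Defs.point t xi i) <= 0.
Hypothesis c_eq0 : forall i, (dot c (Defs.point t xi i) == 0) = (i \in S).

Let F := polytope t xi `&` [set x | dot c x = 0].

Lemma face_convex_comb x : F x -> exists a : 'I_n -> R,
  [/\ forall i, 0 <= a i, \sum_i a i = 1, x = \sum_i a i *: Defs.point t xi i
    & forall i, a i != 0 -> i \in S].
Proof.
case=> /convex_hull_range[a [a0 a1 ->]] /=; rewrite dot_sum => e; exists a; split=> //.
by move=> i ai; rewrite -c_eq0 (convex_comb_eq a0 a1 _ e).
Qed.

Lemma mem_face i : i \in S -> F (Defs.point t xi i).
Proof.
by move=> iS; split; [exact: mem_convex_hull|apply/eqP; rewrite /= c_eq0].
Qed.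

Lemma face_dim m : d = m.+1 -> has_dim F m.
Proof.
move=> dm; have fs := @points_free (enum S) (enum_uniq _).
rewrite -cardE cardS in fs; apply: (has_dim_span (c := xi) (fs (leqnSn d))).
- by rewrite size_map -cardE cardS.
- by move=> _ /mapP[i + ->]; rewrite mem_enum; exact: mem_face.
move=> x /face_convex_comb[a [_ a1 -> aS]]; split; last first.
  by rewrite dot_sum -[RHS]a1; apply: eq_bigr => i _; rewrite dot_point_self mulr1.
apply: rpred_sum => i _; have [->|/aS iS] := eqVneq (a i) 0.
  by rewrite scale0r mem0v.
by rewrite rpredZ // memv_span // map_f // mem_enum.
Qed.

Lemma face_vertices : vertices F = Defs.point t xi @` [set` S].
Proof.
apply/seteqP; split=> [v [c' [b [leb ev]]]|_ [i /= iS <-]].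
  have vF : F v by have [] : (F `&` [set x | dot c' x = b]) v by rewrite -ev.
  have vb : dot c' v = b by have [] : (F `&` [set x | dot c' x = b]) v by rewrite -ev.
  have [a [a0 a1 va aS]] := face_convex_comb vF.
  have [i ai] : exists i, a i != 0.
    apply/existsP; apply: contraTT (oner_neq0 R) => /existsPn a_eq0.
    by rewrite negbK -a1 big1 // => i _; apply/eqP; have := a_eq0 i; rewrite negbK.
  exists i; first exact: aS.
  have iF := mem_face (aS _ ai).
  suff : [set v] (Defs.point t xi i) by [].
  rewrite ev; split=> //=.
  rewrite va dot_sum in vb.
  by apply: (convex_comb_eq a0 a1 _ vb) => // j /aS /mem_face; exact: leb.
pose A := (S :\ i)%SET; pose w := dot (node_form A) (Defs.point t xi i).
have Ad : (#|A| <= d)%N by rewrite -cardS subset_leq_card // subD1set.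
have w0 : w != 0 by rewrite dot_node_form_eq0 // !inE eqxx.
have ww : 0 < w * w by rewrite -expr2 exprn_even_gt0.
pose c' := w *: node_form A.
have c'E x : dot c' x = w * dot (node_form A) x.
  by rewrite /dot mulr_sumr; apply: eq_bigr => j _; rewrite mxE mulrA.
have le j : j \in S -> dot c' (Defs.point t xi j) <= w * w ?= iff (j == i).
  move=> jS; rewrite c'E; have [->|ji] := eqVneq j i; first exact/leifP.
  have /eqP -> : dot (node_form A) (Defs.point t xi j) == 0.
    by rewrite dot_node_form_eq0 // !inE ji.
  by rewrite mulr0; apply/leifP.
exists c', (w * w); split.
  move=> x /face_convex_comb[a [a0 a1 -> aS]]; rewrite dot_sum.
  by apply: convex_comb_le => // j /aS/le[].
apply/seteqP; split=> [_ ->|x [/face_convex_comb[a [a0 a1 -> aS]]]] /=.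
  by split; [exact: mem_face|rewrite /= c'E].
rewrite dot_sum => e.
have ai j : a j != 0 -> j = i.
  move=> aj; apply/eqP; rewrite -(le j (aS _ aj)).2; apply/eqP.
  by apply: (convex_comb_eq a0 a1 _ e aj) => l /aS/le[].
have a0' j : j != i -> a j = 0 by move=> ji; apply/eqP; apply: contraNT ji => /ai ->.
rewrite (bigD1 i) //= big1 => [|j /a0'->]; last by rewrite scale0r.
move: a1; rewrite (bigD1 i) //= big1 => [|j /a0'->//].
by rewrite addr0 => ->; rewrite scale1r addr0.
Qed.

End FacetOfAlternating.

Lemma corresponds_to_facetP S : #|S| = d -> (0 < d < n)%N ->
  corresponds_to_facet t xi S <->
  exists b : bool, forall i, i \notin S ->
    (\prod_(s in S) (t i - t s) * q xi (t i) < 0) = b.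
Proof.
move=> cS /andP[d0 dn]; have cS' : (#|S| <= d)%N by rewrite cS.
have sgE i : i \notin S ->
    (\prod_(s in S) (t i - t s) * q xi (t i) < 0) =
    (dot (node_form S) (Defs.point t xi i) < 0).
  by move=> iS; rewrite dot_node_form // !mulr_lt0 invr_eq0 invr_lt0.
split=> [[F [[c [b [leb FE]]] [m [dP dF]]] vF]|[b Hb]].
  pose g := c - b *: xi.
  have gE i : dot g (Defs.point t xi i) = dot c (Defs.point t xi i) - b.
    rewrite -[b in RHS]mulr1 -(dot_point_self i) /dot mulr_sumr -sumrB.
    by apply: eq_bigr => j _; rewrite !mxE mulrBl mulrA.
  have g0 i : i \in S -> q g (t i) = 0.
    move=> iS; have : F (Defs.point t xi i).
      have /= : vertices F (Defs.point t xi i) by rewrite vF; exists i.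
      case=> c' [b' [_ e]].
      by have [] : (F `&` [set x | dot c' x = b']) (Defs.point t xi i) by rewrite -e.
    rewrite FE => -[_ /= e]; have := gE i; rewrite e subrr dot_point.
    by move/eqP; rewrite mulf_eq0 invr_eq0 (negbTE (q_neq0 i)) orbF => /eqP.
  have [r rE] : exists r, rVpoly g = r * node_poly S.
    rewrite /node_poly -big_enum /= -(big_map t xpredT (fun z => 'X - z%:P)).
    apply: uniq_roots_prod_XsubC.
      by apply/allP => _ /mapP[i + ->]; rewrite mem_enum rootE -q_rVpoly => /g0 ->.
    by rewrite uniq_rootsE map_inj_uniq ?enum_uniq.
  have r0 : r != 0.
    apply/eqP => r0; have qg0 x : q g x = 0 by rewrite q_rVpoly rE r0 mul0r horner0.
    suff FP : F = polytope t xi.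
      by rewrite FP in dF; have := has_dim_uniq dP dF => /eqP; rewrite gtn_eqF.
    rewrite FE; apply/setIidl => x /convex_hull_range[a [_ a1 ->]] /=.
    rewrite dot_sum -[RHS]mul1r -a1 mulr_suml; apply: eq_bigr => i _; congr (_ * _).
    by apply/eqP; rewrite -subr_eq0 -gE dot_point qg0 mul0r.
  have [k rk] : exists k, r = k%:P.
    exists r`_0; apply: size1_polyC; rewrite -(leq_add2r #|S|).
    have : (size (rVpoly g) <= d.+1)%N by exact: size_poly.
    rewrite rE size_proper_mul; last first.
      by rewrite mulf_neq0 ?lead_coef_eq0 // -size_poly_eq0 size_node_poly.
    by rewrite size_node_poly cS addnS /= add1n.
  have k0 : k != 0 by move: r0; rewrite rk polyC_eq0.
  exists (0 < k) => i iS.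
  have : dot g (Defs.point t xi i) <= 0.
    by rewrite gE subr_le0; apply: leb; exact: mem_convex_hull.
  rewrite dot_point q_rVpoly rE rk mul_polyC hornerZ horner_node_poly.
  have := iS; rewrite -node_prod_eq0; move: (\prod_(s in S) _) (q_neq0 i) => /= p q0 p0.
  rewrite le_eqVlt !mulf_eq0 invr_eq0 (negbTE k0) (negbTE p0) (negbTE q0) /=.
  rewrite !mulr_lt0 !mulf_eq0 invr_eq0 invr_lt0 k0 p0 q0 /=.
  rewrite (negbTE k0) (negbTE p0) [0 < k]lt_neqAle [0 == k]eq_sym k0 leNgt /=.
  by case: (k < 0); case: (p < 0); case: (q _ _ < 0).
pose c := (-1) ^+ (~~ b) *: node_form S.
have cE x : dot c x = (-1) ^+ (~~ b) * dot (node_form S) x.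
  by rewrite /dot mulr_sumr; apply: eq_bigr => j _; rewrite mxE mulrA.
have c_eq0 i : (dot c (Defs.point t xi i) == 0) = (i \in S).
  by rewrite cE mulf_eq0 signr_eq0 dot_node_form_eq0.
have c_le0 i : dot c (Defs.point t xi i) <= 0.
  have [iS|iS] := boolP (i \in S).
    by rewrite le_eqVlt c_eq0 iS.
  rewrite le_eqVlt cE mulr_sign_lt0 dot_node_form_eq0 // iS -sgE // Hb //=.
  by rewrite orbC; case: (b).
exists (polytope t xi `&` [set x | dot c x = 0]); last exact: face_vertices.
split.
  exists c, 0; split=> // x /convex_hull_range[a [a0 a1 ->]].
  by rewrite dot_sum; apply: convex_comb_le.
exists d.-1; rewrite prednK //; split; first exact: polytope_dim.
apply: (face_dim cS c_le0 c_eq0); exact: (esym (prednK d0)).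
Qed.

End Facets.

Section ChamberInterior.
Context {R : realType} {d n : nat} (t : 'I_n -> R).
Implicit Types (xi : 'rV[R]_d.+1) (i : 'I_n).

Lemma q_continuous (x : R) : continuous (fun xi : 'rV[R]_d.+1 => q xi x).
Proof.
apply: continuous_big => [|i _ xi]; first exact: add_continuous.
by apply: cvgMr_tmp; [exact: nbhs_filter|exact: (@coord_continuous R 1 d.+1 0 i xi)].
Qed.

Lemma q_shift xi (e x : R) : q (xi + e *: delta_mx 0 0) x = q xi x + e.
Proof.
rewrite /q (bigD1 ord0) //= [in RHS](bigD1 ord0) //= !mxE !eqxx !expr0 !mulr1.
rewrite addrAC; congr (_ + _ + _); apply: eq_bigr => i /negbTE i0.
by rewrite !mxE i0 andbF mulr0 addr0.
Qed.

Lemma chamber_sign sigma i : chamber t sigma ->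
  (forall xi, sigma xi -> 0 <= q xi (t i)) \/ (forall xi, sigma xi -> q xi (t i) <= 0).
Proof.
case=> xi0 xi0c ->; set C := connected_component _ _.
have Cc xi : C xi -> q xi (t i) != 0.
  move/connected_component_sub => cx; apply/eqP => q0.
  by apply: cx; exists i.
have itv : is_interval ((fun xi => q xi (t i)) @` C).
  apply/connected_intervalP/connected_continuous_connected.
    exact: component_connected.
  exact/continuous_subspaceT/q_continuous.
have sep (xi xi' : 'rV[R]_d.+1) : C xi -> C xi' -> q xi (t i) < 0 -> 0 < q xi' (t i) -> False.
  move=> Cxi Cxi' lt0 gt0.
  have im y : C y -> ((fun xi => q xi (t i)) @` C) (q y (t i)) by exists y.
  have mid : q xi (t i) <= 0 <= q xi' (t i) by rewrite !ltW.
  have [xi'' Cxi'' e] := itv _ _ (im _ Cxi) (im _ Cxi') _ mid.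
  by have := Cc _ Cxi''; rewrite e eqxx.
have C0 : C xi0 by exact: connected_component_refl.
have [q0|q0] := ltP 0 (q xi0 (t i)); [left|right] => xi cl; rewrite leNgt; apply/negP => qxi.
  have [|xi' [Cxi' /= lt0]] := cl ((fun xi => q xi (t i)) @^-1` [set y | y < 0]).
    by apply: q_continuous; exact: lt_nbhsl.
  exact: sep Cxi' C0 lt0 q0.
have [|xi' [Cxi' /= gt0]] := cl ((fun xi => q xi (t i)) @^-1` [set y | 0 < y]).
  by apply: q_continuous; exact: lt_nbhsr.
have lt0 : q xi0 (t i) < 0 by rewrite lt_neqAle q0 andbT; exact: Cc.
exact: sep C0 Cxi' lt0 gt0.
Qed.

Lemma chamber_interior_neq0 sigma xi i :
  chamber t sigma -> interior sigma xi -> q xi (t i) != 0.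
Proof.
move=> /(chamber_sign i) sgn int; apply/eqP => q0.
have cont : (fun e : R => xi + e *: delta_mx 0 0) @ (0 : R) --> xi.
  rewrite -[X in _ --> X]addr0 -[X in xi + X](scale0r (delta_mx 0 0)).
  by apply: cvgD; [exact: cvg_cst|apply: cvgZr_tmp; exact: cvg_id].
have /nbhs_ballP[r /= r0 rsub] := cont _ int.
have r2 (e : R) : `|e| = r / 2 -> sigma (xi + e *: delta_mx 0 0).
  move=> er; apply: rsub; rewrite /ball /= sub0r normrN er.
  by rewrite ltr_pdivrMr // ltr_pMr // ltr1n.
have r20 : 0 < r / 2 by rewrite divr_gt0.
case: sgn => [/(_ _ (r2 (- (r / 2)) _))|/(_ _ (r2 (r / 2) _))];
  rewrite q_shift q0 add0r ?normrN gtr0_norm //.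
  by rewrite oppr_ge0 leNgt r20 => /(_ erefl).
by rewrite leNgt r20 => /(_ erefl).
Qed.

End ChamberInterior.

Lemma sgr_eqE (R : realDomainType) (x y : R) : x != 0 -> y != 0 ->
  (Num.sg x == Num.sg y) = ((x < 0) == (y < 0)).
Proof.
move=> /neqr0_sign<- /neqr0_sign<-.
by case: (x < 0); case: (y < 0);
  rewrite ?eqxx //= expr0 expr1 -subr_eq0 ?opprK -?opprD ?oppr_eq0 -mulr2n pnatr_eq0.
Qed.

Lemma prod_lt0 (R : realDomainType) (J : finType) (P : pred J) (f : J -> R) :
  (forall j, P j -> f j != 0) ->
  (\prod_(j | P j) f j < 0) = odd (\sum_(j | P j) (f j < 0)%R)%N.
Proof.
move=> f0; suff [] : \prod_(j | P j) f j != 0 /\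
    (\prod_(j | P j) f j < 0) = odd (\sum_(j | P j) (f j < 0)%R)%N by [].
apply: (big_rec2 (fun p m => p != 0 /\ (p < 0) = odd m)); first by rewrite oner_neq0 ltr10.
move=> j m p Pj [p0 pE]; split; first by rewrite mulf_neq0 ?f0.
by rewrite mulr_lt0 f0 // p0 /= pE oddD oddb.
Qed.

Lemma node_prod_lt0 (R : realDomainType) n (t : 'I_n -> R) (S : {set 'I_n}) i :
  (forall i j : 'I_n, (i < j)%N -> t i < t j) -> i \notin S ->
  (\prod_(s in S) (t i - t s) < 0) = odd (#|S| + count_below S i).
Proof.
move=> ht iS; have neq (s : 'I_n) : s \in S -> s != i by apply: contraTneq => ->.
have ltE (s : 'I_n) : s \in S -> (t i < t s) = (i < s)%N.
  move=> /neq; rewrite -val_eqE /=; case: (ltngtP s i) => // [/ht/ltW|/ht//].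
  by rewrite leNgt => /negbTE.
rewrite prod_lt0 => [|s /[dup] sS /neq si]; last first.
  rewrite subr_eq0; move: si; rewrite -val_eqE /=.
  by case: (ltngtP s i) => // /ht; [move/gt_eqF->|move/lt_eqF->].
rewrite -sum1_card /count_below -big_split /=.
apply: (big_rec2 (fun a b => odd a = odd b)) => // s a b sS e.
rewrite !oddD e /=; congr (_ (+) _).
rewrite subr_lt0 ltE //; move: (neq _ sS); rewrite -val_eqE /=.
by case: (ltngtP s i).
Qed.

Section SignedBlocks.
Context {R : realType} {d n k : nat} (t : 'I_n -> R) (xi : 'rV[R]_d.+1).
Context (I : 'I_k.+1 -> {set 'I_n}).
Hypothesis q_neq0 : forall i, q xi (t i) != 0.
Hypothesis hI : signed_decomposition t xi I.

Let neg i := q xi (t i) < 0.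

Lemma signed_decomposition_blocks : exists2 blk : 'I_n -> 'I_k.+1,
  [/\ forall i i' : 'I_n, (i <= i')%N -> (blk i <= blk i')%N,
      forall j, exists i, blk i = j
    & forall j i, (i \in I j) = (blk i == j)]
  & exists e0 : bool, forall i, (q xi (t i) < 0) = odd (blk i) (+) e0.
Proof.
case: hI => maxI cover ltI; have [blk blkP] := choice cover.
have memI j i : (i \in I j) = (blk i == j).
  apply/idP/eqP => [ij|<-//]; apply: val_inj.
  case: (ltngtP (blk i) j) => // lt_; first by have := ltI _ _ lt_ i i (blkP i) ij; rewrite ltnn.
  by have := ltI _ _ lt_ i i ij (blkP i); rewrite ltnn.
have mono (i i' : 'I_n) : (i <= i')%N -> (blk i <= blk i')%N.
  move=> ii'; rewrite leqNgt; apply/negP => lt_.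
  by have := ltI _ _ lt_ i' i (blkP i') (blkP i); rewrite ltnNge ii'.
have surj j : exists i, blk i = j.
  have /maxsetP[/and3P[/finset.set0Pn[i ij] _ _] _] := maxI j.
  by exists i; apply/eqP; rewrite -memI.
have same i i' : blk i = blk i' -> neg i = neg i'.
  move=> ii'; have /maxsetP[/and3P[_ _ /forall_inP sgI] _] := maxI (blk i).
  have /forall_inP/(_ i') : [forall j in I (blk i), Num.sg (q xi (t i)) == Num.sg (q xi (t j))].
    by apply: sgI; rewrite memI.
  by rewrite memI ii' eqxx sgr_eqE // => /(_ isT)/eqP.
have alt (i i' : 'I_n) : blk i' = (blk i).+1 :> nat -> neg i' = ~~ neg i.
  move=> ii'; apply/eqP; rewrite -[_ == _]negbK; apply/negP => nn.
  have eq_neg : neg i' = neg i by move: nn; case: (neg i); case: (neg i').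
  have memU l : (l \in I (blk i) :|: I (blk i'))%SET = (blk i <= blk l <= blk i')%N.
    rewrite finset.in_setU !memI -!val_eqE /= ii'.
    rewrite [RHS]andbC leq_eqVlt ltnS andb_orl -eqn_leq orbC.
    by case: eqP => //= ->; rewrite leqnSn.
  have negU l : l \in (I (blk i) :|: I (blk i'))%SET -> neg l = neg i.
    by rewrite finset.in_setU !memI => /orP[]/eqP/same ->.
  have /maxsetP[_ maxi] := maxI (blk i).
  have := maxi (I (blk i) :|: I (blk i'))%SET.
  rewrite finset.subsetUl => /(_ _ isT) eU.
  have : i' \in I (blk i).
    rewrite -eU; first by rewrite memU leqnn ii' leqnSn.
    apply/and3P; split.
    - by apply/finset.set0Pn; exists i; rewrite memU leqnn ii' leqnSn.
    - apply/forall_inP => x xU; apply/forall_inP => y yU.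
      apply/forallP => l; apply/implyP => /andP[xl ly].
      move: xU yU; rewrite !memU => /andP[ix _] /andP[_ yi].
      by rewrite (leq_trans ix (mono _ _ xl)) (leq_trans (mono _ _ ly) yi).
    - apply/forall_inP => x /negU nx; apply/forall_inP => y /negU ny.
      by rewrite sgr_eqE //; move: nx ny; rewrite /neg => -> ->.
  by rewrite memI => /eqP e; move: ii'; rewrite e => /eqP; rewrite ltn_eqF.
exists blk => //; have [i0 bi0] := surj ord0; exists (neg i0).
suff H m i : blk i = m :> nat -> neg i = odd m (+) neg i0 by move=> i; exact: H.
elim: m i => [|m IHm] i bi; first by apply: same; rewrite bi0; exact: val_inj.
have mk : (m < k.+1)%N by rewrite ltnW // -bi.
have [i' bi'] := surj (Ordinal mk).
by rewrite (alt i' i) ?bi ?bi' // (IHm i') ?bi' //= addNb.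
Qed.

End SignedBlocks.

Theorem theorem3p6 (R : realType) (d n : nat)
    (hd : (1 <= d)%N) (hn : (d + 1 <= n)%N)
    (t : 'I_n -> R) (ht : forall i j : 'I_n, (i < j)%N -> t i < t j)
    (sigma : set 'rV[R]_d.+1) (hsigma : chamber t sigma)
    (xi : 'rV[R]_d.+1) (hxi : interior sigma xi)
    (k : nat) (I : 'I_k.+1 -> {set 'I_n}) (hI : signed_decomposition t xi I)
    (S : {set 'I_n}) (hS : #|S| = d) :
  (corresponds_to_facet t xi S <->
     exists S1 S2 S3 : {set 'I_n}, facet_decomposition d I S S1 S2 S3)
  /\
  (corresponds_to_facet t xi S ->
     forall S1 S2 S3 S1' S2' S3' : {set 'I_n},
       facet_decomposition d I S S1 S2 S3 ->
       facet_decomposition d I S S1' S2' S3' ->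
       [/\ S1 = S1', S2 = S2' & S3 = S3']).
Proof.
have q0 i : q xi (t i) != 0 by exact: chamber_interior_neq0 hsigma hxi.
have dn : (d < n)%N by rewrite -addn1.
have n1 : (1 < n)%N by exact: leq_ltn_trans dn.
have t_inj : injective t.
  move=> i j tij; apply: val_inj => /=; have [/ht|/ht|//] := ltngtP i j; by rewrite tij ltxx.
have [blk [mono surj memI] [e0 negE]] := signed_decomposition_blocks q0 hI.
split; last by move=> _ *; exact: (facet_decomposition_unique mono surj memI n1 hS dn).
have signE i : i \notin S -> (\prod_(s in S) (t i - t s) * q xi (t i) < 0) =
    odd (count_below S i + blk i) (+) (odd d (+) e0).
  move=> iS; rewrite mulr_lt0 node_prod_eq0 // iS q0 negE node_prod_lt0 // hS !oddD /=.
  by case: (odd d); case: (odd (blk i)); case: (odd (count_below S i)); case: (e0).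
rewrite (corresponds_to_facetP t_inj q0 hS) ?hd //; split=> [[b bE]|].
  apply: (@facet_decomposition_exists _ _ blk I mono surj memI _ _ (b (+) (odd d (+) e0)) n1 hS).
  by move=> i iS; rewrite -(bE i iS) signE // -addbA addbb addbF.
case=> S1 [S2 [S3 dec]].
have bn : (n.-1 < n)%N by rewrite prednK // ltnW.
have [||_ _ parS _] := @facet_decomposition_parity _ _ blk I mono surj memI d S S1 S2 S3
  (Ordinal (ltnW n1)) (Ordinal bn) _ _ n1 hS dec => //=; first by rewrite prednK // ltnW.
by eexists => i iS; rewrite signE // parS.
Qed.
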